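(* Let $X$ be a real Banach space with dual $X^*$. Let $A, B\colon X\rightrightarrows X^*$ be maximally monotone operators with $\operatorname{dom} A\cap\operatorname{int}\operatorname{dom} B\neq\varnothing$. Assume that the operator $A+N_{\overline{\operatorname{dom} B}}$ is of type (FPV). Then $A+B$ is maximally monotone.
   Context: $X$ is a real Banach space, $X^*$ its continuous dual, $\langle\cdot,\cdot\rangle$ the duality pairing. For a set-valued operator $A\colon X\rightrightarrows X^*$ (i.e. $Ax\subseteq X^*$ for every $x\in X$), $\operatorname{gra}A=\{(x,x^* )\in X\times X^* : x^*\in Ax\}$ and $\operatorname{dom}A=\{x\in X: Ax\neq\varnothing\}$. $A$ is monotone if $\langle x-y,x^*-y^*\rangle\ge 0$ for all $(x,x^* ),(y,y^* )\in\operatorname{gra}A$; it is maximally monotone if it is monotone and has no proper monotone extension (in the sense of graph inclusion). The sum is $(A+B)x=\{a^*+b^* : a^*\in Ax,\ b^*\in Bx\}$. A point $(x,x^* )\in X\times X^*$ is monotonically related to a set $G\subseteq X\times X^*$ if $\langle x-y,x^*-y^*\rangle\ge 0$ for all $(y,y^* )\in G$. An operator $A$ is of type (FPV) if it is maximally monotone and, for every open convex set $U\subseteq X$ with $U\cap\operatorname{dom}A\neq\varnothing$, the following implication holds: if $x\in U$ and $(x,x^* )$ is monotonically related to $\operatorname{gra}A\cap(U\times X^* )$, then $(x,x^* )\in\operatorname{gra}A$. For $C\subseteq X$, $\operatorname{int}C$ is the norm interior, $\overline{C}$ the norm closure, and the normal cone operator is $N_C(x)=\{x^*\in X^*: \sup_{c\in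 C}\langle c-x,x^*\rangle\le 0\}$ if $x\in C$ and $N_C(x)=\varnothing$ if $x\notin C$. *)

(* Defs.v *)
From HB Require Import structures.
From mathcomp Require Import all_boot all_order all_algebra.
From mathcomp Require Import all_classical all_reals all_analysis.

Set Implicit Arguments.
Unset Strict Implicit.
Unset Printing Implicit Defensive.

Import Order.TTheory GRing.Theory Num.Theory.
Import numFieldNormedType.Exports.

Local Open Scope classical_set_scope.
Local Open Scope ring_scope.

(* MathComp-Analysis has no type of continuous linear functionals: it is built
   here as a subtype of X -> R^o, and its vector space operations are the
   pointwise ones inherited from X -> R^o. *)
Section Dual.
Context (R : realType) (X : normedModType R).

Definition cont_linear : {pred (X -> R^o)} :=
  mem [set f : X -> R^o | linear f /\ continuous f].

Record dual := Dual { dual_fun :> X -> R^o; _ : dual_fun \in cont_linear }.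

HB.instance Definition _ := [isSub for dual_fun].
HB.instance Definition _ := [Choice of dual by <:].

Lemma cont_linear_submod_closed : submod_closed cont_linear.
Proof.
split.
  rewrite inE /=; split=> [a x y|x]; first by rewrite /= scaler0 addr0.
  exact: cst_continuous.
move=> a f g; rewrite !inE /= => -[lf cf] [lg cg]; split=> [k x y|x].
  rewrite /= !fctE lf lg !scalerDr !scalerA [a * k]mulrC.
  by rewrite -!addrA; congr (_ + _); rewrite addrCA.
by apply: continuousD; [apply: continuousZl_tmp; exact: cf | exact: cg].
Qed.

HB.instance Definition _ :=
  GRing.isSubmodClosed.Build _ _ cont_linear cont_linear_submod_closed.
HB.instance Definition _ := [SubChoice_isSubLmodule of dual by <:].

Lemma dual_linear (f : dual) : linear f.
Proof. by case: f => f /=; rewrite inE => -[]. Qed.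

Lemma dual_continuous (f : dual) : continuous (f : X -> R^o).
Proof. by case: f => f /=; rewrite inE => -[]. Qed.

HB.instance Definition _ (f : dual) :=
  GRing.isLinear.Build R X R^o _ (f : X -> R^o) (dual_linear f).

Lemma dualP (f g : dual) : (forall x, f x = g x) -> f = g.
Proof. by move=> fg; apply/val_inj/funext. Qed.

Lemma dualDE (f g : dual) x : (f + g) x = f x + g x.
Proof. by []. Qed.

Lemma dualBE (f g : dual) x : (f - g) x = f x - g x.
Proof. by []. Qed.

Definition pairing (x : X) (f : dual) : R := f x.

End Dual.

Notation "''<' x , f >" := (pairing x f)
  (at level 0, x, f at level 69, format "''<' x ,  f >") : ring_scope.

Section Operators.
Context (R : realType) (X : normedModType R).
Implicit Types (A B : X -> set (dual X)) (C U : set X).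

Definition gra A : set (X * dual X) := [set p | A p.1 p.2].

Definition dom A : set X := [set x | A x !=set0].

Definition monotone_op A : Prop :=
  forall p q, gra A p -> gra A q -> 0 <= '<p.1 - q.1, p.2 - q.2>.

Definition maximally_monotone A : Prop :=
  monotone_op A /\ ~ exists B, monotone_op B /\ gra A `<` gra B.

Definition op_add A B : X -> set (dual X) :=
  fun x => [set a + b | a in A x & b in B x].

Definition monotonically_related (p : X * dual X) (G : set (X * dual X)) :=
  forall q, G q -> 0 <= '<p.1 - q.1, p.2 - q.2>.

Definition type_FPV A : Prop :=
  maximally_monotone A /\
  forall U, open U -> convex_set U -> U `&` dom A !=set0 ->
    forall x (xs : dual X), U x ->
      monotonically_related (x, xs) (gra A `&` (U `*` [set: dual X])) ->
      gra A (x, xs).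

Definition normal_cone C : X -> set (dual X) :=
  fun x => [set xs | C x /\
    (ereal_sup [set ('<c - x, xs>)%:E | c in C] <= 0)%E].

End Operators.

(* Main.v *)
Require Import Defs.
From HB Require Import structures.
From mathcomp Require Import all_boot all_order all_algebra.
From mathcomp Require Import all_classical all_reals all_analysis.
From mathcomp Require Import ring lra.

(** Write [S = A + B], let [C] be the closure of [dom B], and fix [x0] in
    [dom A] and in the interior of [dom B].  As [B + N_C] is a monotone extension
    of the maximal operator [B], it equals [B]; hence [S = (A + N_C) + B], and [A]
    may be replaced by [A + N_C], which is of type (FPV) and has its domain
    inside [C].

    Say that [(z, zs)] has gap [e > 0] if [<z - x, zs - xs> >= e] on the graph of
    [S].  The proof has two halves.

    If no point has a gap, then [S] is maximal ([sum_mem_of_no_gap]).  For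
    [(z, zs)] monotonically related to [S], consider the epigraphs of the
    Fitzpatrick functions of [A] and [B], tilted by [z] so as to become convex
    subsets of [X * R].  A negative sum of two ordinates over the same point would
    give a gap to a point close to [(z, zs)]; so the two epigraphs lie on
    opposite sides, and [B] being locally bounded at [x0] provides the interior
    point that the sandwich theorem needs.  The separating functional [f] satisfies
    [f \in A z] and [zs - f \in B z].

    No point has a gap.  Type (FPV) is used on thin open tubes around segments
    that start at [x0]: for any [ws] it yields a point [a] of [dom A] in the
    tube and [xs \in A a] with [<z - a, ws> <= <z - a, xs>], while a gap bounds
    [<z - a, xs> + <z - a, b>] from above for [b \in B a].  Local boundedness at
    [x0] makes the norm of [b] controlled by its value along the segment
    ([growth_near_segment]), so a steep [ws] produces a contradiction as soon as
    [a] is in [dom B].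
    - If [z] is in the interior of [dom B], a thin tube is contained in [dom B]
      ([no_gap_interior]).
    - If [z] is in [C], moving it slightly towards [x0] keeps half of the gap
      and brings it into the interior of [dom B] ([no_gap_closure]).
    - If [z] is outside [C], then [a] is only known to lie in [C].  Approach [a]
      by interior points [p] and apply (FPV) again, in tubes around [[x0, p]]
      contained in the interior of [dom B] and with the slope [xs + m], where [m]
      is positive on [a - x0].  The gap then forces the points [y] obtained
      to converge to [a], with bounded values of [B]; by maximality of [B] the
      limit [a] is in [dom B] after all ([dom_of_gap], [no_gap_outside]). *)

Import Order.TTheory GRing.Theory Num.Theory.
Import numFieldNormedType.Exports.

Local Open Scope classical_set_scope.
Local Open Scope ring_scope.

Set Implicit Arguments.
Unset Strict Implicit.
Unset Printing Implicit Defensive.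

(** Several smallness conditions on one radius or weight are met at once. *)
Lemma exists_pos_le (R : realType) (s : seq R) : all (fun a : R => 0 < a) s ->
  exists2 d : R, 0 < d & all (fun a : R => d <= a) s.
Proof.
elim: s => [_|a s IH /= /andP[a0 /IH[d d0 ds]]]; first by exists 1.
exists (Num.min a d); first by rewrite lt_min a0.
rewrite ge_min lexx /=; apply: sub_all ds => c dc.
by rewrite ge_min dc orbT.
Qed.

(** * The Hahn-Banach theorem *)

Section HahnBanach.
Context {R : realType} {V : lmodType R}.
Implicit Types (p q : V -> R) (x y : V).

Definition sublinear p :=
  (forall x y, p (x + y) <= p x + p y) /\
  (forall t x, 0 < t -> p (t *: x) <= t * p x).

Lemma sublinear0 p : sublinear p -> p 0 = 0.
Proof.
move=> [_ hp]; apply/eqP; rewrite eq_le.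
have := hp 2%:R 0 ltac:(lra); have := hp 2%:R^-1 0 ltac:(lra).
by rewrite !scaler0 => h1 h2; apply/andP; split; lra.
Qed.

Lemma sublinearN p x : sublinear p -> - p (- x) <= p x.
Proof.
move=> sp; have := sp.1 x (- x); rewrite subrr (sublinear0 sp); lra.
Qed.

(** The infimum is finite because [- p (- x)] bounds every sublinear minorant of
    [p] from below; it is subadditive because of two members of a chain the smaller
    one serves both summands. *)
Lemma sublinear_chain_inf p (A : set (V -> R)) :
  A !=set0 -> (forall q, A q -> sublinear q /\ forall x, q x <= p x) ->
  (forall q q', A q -> A q' -> (forall x, q x <= q' x) \/ (forall x, q' x <= q x)) ->
  exists q0, [/\ sublinear q0, forall x, q0 x <= p x &
    forall q, A q -> forall x, q0 x <= q x].
Proof.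
move=> [a Aa] Asub Atot.
pose E x := [set q x | q in A].
have lbE x : lbound (E x) (- p (- x)).
  move=> _ [q Aq <-]; have [sq qp] := Asub q Aq.
  by apply: le_trans (sublinearN x sq); rewrite lerN2.
have infE x : has_inf (E x).
  by split; [exists (a x), a | exists (- p (- x))].
have infle q x : A q -> inf (E x) <= q x.
  by move=> Aq; apply: ge_inf; [case: (infE x)|exists q].
exists (fun x => inf (E x)); split => [|x|q Aq x]; last exact: infle.
  split=> [x y|t x t0].
    rewrite -lerBlDr; apply: lb_le_inf; first by case: (infE x).
    move=> _ [q Aq <-]; rewrite lerBlDr -lerBlDl.
    apply: lb_le_inf; first by case: (infE y).
    move=> _ [q' Aq' <-]; rewrite lerBlDl.
    have [h|h] := Atot q q' Aq Aq'.
      apply: le_trans (infle q _ Aq) _.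
      by apply: le_trans ((Asub q Aq).1.1 x y) _; rewrite lerD2l.
    apply: le_trans (infle q' _ Aq') _.
    by apply: le_trans ((Asub q' Aq').1.1 x y) _; rewrite lerD2r.
  rewrite -ler_pdivrMl//; apply: lb_le_inf; first by case: (infE x).
  move=> _ [q Aq <-]; rewrite ler_pdivrMl//.
  exact: le_trans (infle q _ Aq) ((Asub q Aq).1.2 t x t0).
exact: le_trans (infle a x Aa) ((Asub a Aa).2 x).
Qed.

(** The infimum of [q (x + t *: y) - t * q y] over [t >= 0] is again sublinear,
    so a minimal [q] must be odd along [y]. *)
Lemma sublinear_lower q y : sublinear q ->
  exists q', [/\ sublinear q', forall x, q' x <= q x & q' (- y) <= - q y].
Proof.
move=> sq; pose E x := [set q (x + t *: y) - t * q y | t in [set t | 0 <= t]].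
have qty t x : 0 <= t -> q (t *: x) <= t * q x.
  rewrite le_eqVlt => /predU1P[<-|]; last exact: sq.2.
  by rewrite scale0r mul0r (sublinear0 sq).
have lbE x : lbound (E x) (- q (- x)).
  move=> _ [t /= t0 <-].
  have := sq.1 (- x) (x + t *: y); rewrite addrA addNr add0r.
  have := qty t y t0.
  have : t * q y <= q (t *: y).
    move: t0; rewrite le_eqVlt => /predU1P[<-|t0].
      by rewrite scale0r mul0r (sublinear0 sq).
    have := sq.2 t^-1 (t *: y) ltac:(by rewrite invr_gt0).
    by rewrite scalerA mulVf ?gt_eqF// scale1r ler_pdivlMl.
  lra.
have infE x : has_inf (E x).
  by split; [exists (q (x + 0 *: y) - 0 * q y), 0 => /= | exists (- q (- x))].
have infle t x : 0 <= t -> inf (E x) <= q (x + t *: y) - t * q y.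
  by move=> t0; apply: ge_inf; [case: (infE x)|exists t].
exists (fun x => inf (E x)); split=> [|x|].
- split=> [x x'|s x s0].
    rewrite -lerBlDr; apply: lb_le_inf; first by case: (infE x).
    move=> _ [t /= t0 <-]; rewrite lerBlDr -lerBlDl.
    apply: lb_le_inf; first by case: (infE x').
    move=> _ [t' /= t'0 <-]; rewrite lerBlDl.
    apply: le_trans (infle (t + t') _ _) _; first exact: addr_ge0.
    have := sq.1 (x + t *: y) (x' + t' *: y).
    rewrite scalerDl addrACA; lra.
  rewrite -ler_pdivrMl//; apply: lb_le_inf; first by case: (infE x).
  move=> _ [t /= t0 <-]; rewrite ler_pdivrMl//.
  apply: le_trans (infle (s * t) _ _) _; first by rewrite mulr_ge0// ltW.
  have := sq.2 s (x + t *: y) s0; rewrite scalerDr scalerA; lra.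
- by apply: le_trans (infle 0 _ _) _ => //; rewrite scale0r mul0r addr0 subr0.
- apply: le_trans (infle 1 _ _) _ => //.
  by rewrite scale1r addNr mul1r (sublinear0 sq) sub0r.
Qed.

(** Zorn's lemma gives a minimal sublinear minorant of [p].  By
    [sublinear_lower] it is odd, and an odd sublinear functional is linear. *)
Theorem hahn_banach p : sublinear p ->
  exists l : V -> R, (forall a x y, l (a *: x + y) = a * l x + l y) /\
    forall x, l x <= p x.
Proof.
move=> sp.
pose T := {q : V -> R | sublinear q /\ forall x, q x <= p x}.
pose below (q q' : T) : bool := `[< forall x, sval q' x <= sval q x >].
have [||||[q [sq qp]] qmin] := @Zorn T below.
- by move=> q; apply/asboolP.
- move=> q r s /asboolP h1 /asboolP h2; apply/asboolP => x.
  exact: le_trans (h2 x) (h1 x).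
- move=> [q Hq] [r Hr] /asboolP /= h1 /asboolP /= h2.
  apply: eq_exist; apply/funext => x; apply/eqP; rewrite eq_le.
  by rewrite h1 h2.
- move=> A Atot; have [->|/set0P[a Aa]] := eqVneq A set0.
    by exists (exist _ p (conj sp (fun x => lexx _))) => ?.
  have [||q r [s As <-] [t At <-]|q [sq qp qA]] :=
    @sublinear_chain_inf p (sval @` A).
  + by exists (sval a), a.
  + by move=> _ [s As <-]; exact: (svalP s).
  + by have [/asboolP|/asboolP] := Atot s t As At; [right|left].
  exists (exist _ q (conj sq qp)) => s As; apply/asboolP => x /=.
  by apply: qA; exists s.
have odd y : q (- y) = - q y.
  have [q' [sq' q'q q'y]] := sublinear_lower y sq.
  have q'p x : q' x <= p x by exact: le_trans (q'q x) (qp x).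
  have /(congr1 sval) /= q'E := qmin (exist _ q' (conj sq' q'p)) (asboolT q'q).
  apply/eqP; rewrite eq_le; apply/andP; split; first by rewrite -{1}q'E.
  by have := sublinearN y sq; rewrite lerNl.
have add x y : q (x + y) = q x + q y.
  apply/eqP; rewrite eq_le sq.1 /=.
  have := sq.1 (- x) (- y); rewrite -opprD !odd; lra.
have pos t x : 0 < t -> q (t *: x) = t * q x.
  move=> t0; apply/eqP; rewrite eq_le sq.2//=.
  have := sq.2 t^-1 (t *: x) ltac:(by rewrite invr_gt0).
  by rewrite scalerA mulVf ?gt_eqF// scale1r ler_pdivlMl.
exists q; split=> // a x y; rewrite add; congr (_ + _).
have [a0|a0|->] := ltgtP a 0; first 1 last.
- exact: pos.
- by rewrite scale0r mul0r (sublinear0 sq).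
- rewrite -{1}[a]opprK scaleNr odd pos ?oppr_gt0//; ring.
Qed.
End HahnBanach.

(** * Continuous linear functionals *)

(* Simplification would otherwise unfold the pointwise operations of the dual and
   leave values in the regular algebra of R instead of R. *)
Arguments pairing : simpl never.

Section DualFunctionals.
Context {R : realType} {X : normedModType R}.
Implicit Types (x y h : X) (f g : dual X) (K : R).

Lemma pairingDl x y f : '<x + y, f> = '<x, f> + '<y, f>.
Proof. exact: linearD. Qed.

Lemma pairingNl x f : '<- x, f> = - '<x, f>.
Proof. exact: linearN. Qed.

Lemma pairing0l f : '<0, f> = 0.
Proof. exact: linear0. Qed.

Lemma pairingZl (a : R) x f : '<a *: x, f> = a * '<x, f>.
Proof.
by rewrite /pairing -[a *: x]addr0 dual_linear -[f 0]/('<0, f>) pairing0l addr0.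
Qed.

Lemma pairingDr x f g : '<x, f + g> = '<x, f> + '<x, g>.
Proof. by []. Qed.

Lemma pairingNr x f : '<x, - f> = - '<x, f>.
Proof. by []. Qed.

Lemma pairingZr x (a : R) f : '<x, a *: f> = a * '<x, f>.
Proof. by []. Qed.

Lemma pairing0r x : '<x, 0> = 0.
Proof. by []. Qed.

Definition pairingE := (pairingDl, pairingNl, pairingZl, pairing0l,
  pairingDr, pairingNr, pairingZr, pairing0r).

Lemma dual_bounded f : exists2 K : R, 0 <= K & forall h, '<h, f> <= K * `|h|.
Proof.
have /(@continuous_linear_bounded _ _ _ 0)/linear_boundedP :=
  @dual_continuous R X f 0.
move=> /pinfty_ex_gt0 [K K0 fK]; exists K => [|h]; first exact: ltW.
exact: le_trans (ler_norm _) (fK h).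
Qed.

Lemma dual_of_bounded (l : X -> R) K :
  (forall (a : R) x y, l (a *: x + y) = a * l x + l y) ->
  (forall x, l x <= K * `|x|) -> exists f, forall x, '<x, f> = l x.
Proof.
move=> llin lK.
pose L := HB.pack (l : X -> R^o)
  (GRing.isLinear.Build R X R^o _ (l : X -> R^o) llin) : {linear X -> R^o}.
have lc : continuous (L : X -> R^o).
  apply/linear_bounded_continuous/linear_boundedP.
  near=> r => x; apply: (@le_trans _ _ (K * `|x|)).
    rewrite ler_norml lK andbT -[`|x|]normrN lerNl.
    by have := lK (- x); rewrite -[l (- x)]/(L (- x)) linearN.
  by rewrite ler_wpM2r//; near: r; exact: nbhs_pinfty_ge.
have lin : (l : X -> R^o) \in @cont_linear R X by rewrite inE; split.
by exists (Dual lin).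
Unshelve. all: by end_near. Qed.
End DualFunctionals.

(** * Separation of convex sets *)

Section ConvexSeparation.
Context {R : realType} {X : normedModType R}.
Implicit Types (x y h k : X) (f : dual X) (D P Q : set (X * R)).

Let weight01 (a b : R) : 0 < a -> 0 < b -> 0 <= a / (a + b) <= 1.
Proof.
move=> a0 b0; have ab : 0 < a + b by rewrite addr_gt0.
rewrite divr_ge0 ?(ltW a0) ?(ltW ab)//= (ler_pdivrMr _ _ ab) mul1r.
by rewrite lerDl ltW.
Qed.

Definition convex_pairs D := forall h k (s u t : R), 0 <= t <= 1 ->
  D (h, s) -> D (k, u) -> D ((1 - t) *: h + t *: k, (1 - t) * s + t * u).

(** With [D] the epigraph of a convex function that is nonnegative at [0] and
    bounded above near [0], this is a subgradient at [0].  The gauge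
    [p x = inf {s / t | t > 0, D (t *: x, s)}] is sublinear, because the combination
    of [t *: x] and [t' *: y] with weights [t'] and [t] is a multiple of [x + y];
    it is bounded by a multiple of the norm, and any linear functional below it is
    below [D]. *)
Theorem convex_minorant D (r M : R) : convex_pairs D -> 0 < r ->
  (forall s, D (0, s) -> 0 <= s) ->
  (forall h, `|h| <= r -> exists2 s, s <= M & D (h, s)) ->
  exists f, forall h s, D (h, s) -> '<h, f> <= s.
Proof.
move=> Dcvx r0 D0 Dr.
pose E x := [set a : R | exists t s : R, [/\ 0 < t, D (t *: x, s) & a = s / t]].
have normS x : 0 < `|x| + 1 by rewrite ltr_wpDl.
have rS x : 0 < r / (`|x| + 1) by rewrite divr_gt0.
have rSx x : `|(r / (`|x| + 1)) *: x| <= r.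
  rewrite normrZ (gtr0_norm (rS x)) mulrAC (ler_pdivrMr _ _ (normS x)).
  rewrite ler_wpM2l ?(ltW r0)//.
  by lra.
have lbE x : has_lbound (E x).
  have [s0 _ Ds0] := Dr _ (rSx (- x)); rewrite normrN in Ds0.
  set t0 := r / _ in Ds0; have t00 : 0 < t0 by exact: rS.
  exists (- (s0 / t0)) => _ [t [s [t_gt0 Ds ->]]].
  have tt0 : 0 < t + t0 by rewrite addr_gt0.
  have := Dcvx _ _ _ _ (t / (t + t0)) _ Ds Ds0.
  move=> /(_ (weight01 t_gt0 t00)).
  rewrite scalerN -scaleNr !scalerA -scalerDl.
  have -> : (1 - t / (t + t0)) * t + t / (t + t0) * - t0 = 0.
    by field; rewrite gt_eqF.
  rewrite scale0r => /D0.
  have -> : (1 - t / (t + t0)) * s + t / (t + t0) * s0 =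
            (s / t + s0 / t0) * (t * t0 / (t + t0)).
    by field; rewrite !gt_eqF.
  by rewrite pmulr_lge0 ?divr_gt0 ?mulr_gt0//; lra.
have infE x : has_inf (E x).
  split => //; have [s _ Ds] := Dr _ (rSx x).
  by exists (s / (r / (`|x| + 1))), (r / (`|x| + 1)), s.
have infle x t s : 0 < t -> D (t *: x, s) -> inf (E x) <= s / t.
  by move=> t0 Ds; apply: ge_inf => //; exists t, s.
have [|l [llin lE]] := @hahn_banach R X (fun x => inf (E x)).
  split=> [x y|c x c0].
    rewrite -lerBlDr; apply: lb_le_inf; first by case: (infE x).
    move=> _ [t [s [t0 Ds ->]]]; rewrite lerBlDr -lerBlDl.
    apply: lb_le_inf; first by case: (infE y).
    move=> _ [t' [s' [t'0 Ds' ->]]]; rewrite lerBlDl.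
    have tt' : 0 < t + t' by rewrite addr_gt0.
    have := Dcvx _ _ _ _ (t / (t + t')) _ Ds Ds'.
    move=> /(_ (weight01 t0 t'0)).
    have -> : (1 - t / (t + t')) *: (t *: x) + (t / (t + t')) *: (t' *: y) =
              (t * t' / (t + t')) *: (x + y).
      by rewrite scalerDr !scalerA; congr (_ *: _ + _ *: _); field; rewrite gt_eqF.
    move/infle => /(_ ltac:(by rewrite divr_gt0 ?mulr_gt0))/le_trans; apply.
    by rewrite le_eqVlt; apply/orP; left; apply/eqP; field; rewrite !gt_eqF.
  rewrite -ler_pdivrMl//; apply: lb_le_inf; first by case: (infE x).
  move=> _ [t [s [t0 Ds ->]]]; rewrite ler_pdivrMl//.
  apply: le_trans (infle _ (t / c) s _ _) _; first by rewrite divr_gt0.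
    by rewrite scalerA divfK// gt_eqF.
  by rewrite le_eqVlt; apply/orP; left; apply/eqP; field; rewrite !gt_eqF.
have [|f fl] := @dual_of_bounded _ _ l (M / r) llin.
  move=> x; have [->|x0] := eqVneq x 0.
    have := llin 0 0 0; rewrite scale0r addr0 mul0r add0r normr0 mulr0.
    by move=> l0; have := llin 1 0 0; rewrite scale1r addr0; lra.
  have nx0 : 0 < `|x| by rewrite normr_gt0.
  have [|s sM Ds] := Dr ((r / `|x|) *: x).
    by rewrite normrZ gtr0_norm ?divr_gt0// divfK ?gt_eqF.
  apply: le_trans (lE x) _; apply: le_trans (infle _ _ _ _ Ds) _.
    by rewrite divr_gt0.
  rewrite invf_div mulrA mulrAC ler_wpM2r ?normr_ge0// ler_wpM2r//.
  by rewrite invr_ge0 ltW.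
exists f => h s Ds; rewrite fl; apply: le_trans (lE h) _.
by rewrite -[s]divr1; apply: infle => //; rewrite scale1r.
Qed.

(** [convex_minorant] applied to the differences of points of [P] and [Q], which
    represent a convex function and the opposite of a concave function below it;
    the bound on [Q] near a point of [P] is the qualification condition. *)
Theorem convex_sandwich P Q h0 (s0 r M : R) :
  convex_pairs P -> convex_pairs Q ->
  (forall h s u, P (h, s) -> Q (h, u) -> 0 <= s + u) ->
  P (h0, s0) -> 0 < r ->
  (forall h, `|h - h0| <= r -> exists2 u, u <= M & Q (h, u)) ->
  exists f b, (forall h s, P (h, s) -> '<h, f> + b <= s) /\
    (forall h u, Q (h, u) -> - ('<h, f> + b) <= u).
Proof.
move=> Pc Qc PQ P0 r0 Qr.
pose D := [set hs : X * R | exists h s k u,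
  [/\ P (h, s), Q (k, u) & hs = (h - k, s + u)]].
have [||||f fD] := @convex_minorant D r (s0 + M).
- move=> x y a b t t01 [h [s [k [u [Ph Qk [-> ->]]]]]].
  move=> [h' [s' [k' [u' [Ph' Qk' [-> ->]]]]]].
  exists ((1 - t) *: h + t *: h'), ((1 - t) * s + t * s').
  exists ((1 - t) *: k + t *: k'), ((1 - t) * u + t * u').
  split; [exact: Pc|exact: Qc|].
  by congr (_, _); [rewrite !scalerBr opprD addrACA|ring].
- by [].
- move=> a [h [s [k [u [Ph Qk [/esym/eqP]]]]]].
  by rewrite subr_eq0 => /eqP hk ->; apply: (PQ k) => //; rewrite -hk.
- move=> h hr; have [|u uM Qu] := Qr (h0 - h).
    by rewrite addrC addKr normrN.
  by exists (s0 + u); [rewrite lerD2l|exists h0, s0, (h0 - h), u; rewrite subKr].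
have fPQ h s k u : P (h, s) -> Q (k, u) -> '<h, f> - s <= '<k, f> + u.
  move=> Ph Qk; have := fD (h - k) (s + u); rewrite pairingDl pairingNl.
  by move=> /(_ ltac:(by exists h, s, k, u)); lra.
have [u0 _ Q0] : exists2 u, u <= M & Q (h0, u) by apply: Qr; rewrite subrr normr0 ltW.
pose E := [set a | exists h s, P (h, s) /\ a = '<h, f> - s].
have supE h s : P (h, s) -> '<h, f> - s <= sup E.
  move=> Ph; apply: sup_ubound; last by exists h, s.
  by exists ('<h0, f> + u0) => _ [h' [s' [Ph' ->]]]; exact: fPQ.
exists f, (- sup E); split=> [h s /supE|k u Qk]; first lra.
rewrite opprD opprK addrC lerBlDl; apply: ge_sup; first by exists ('<h0, f> - s0), h0, s0.
by move=> _ [h [s [Ph ->]]]; exact: fPQ.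
Qed.

(** A subgradient of the norm at [x]. *)
Lemma dual_norming x : exists f, `|x| <= '<x, f>.
Proof.
have [||||f fD] := @convex_minorant [set hs | `|hs.1 + x| - `|x| <= hs.2] 1 1.
- move=> h k s u t /andP[t0 t1] /= hs ku.
  have -> : (1 - t) *: h + t *: k + x = (1 - t) *: (h + x) + t *: (k + x).
    by rewrite !scalerDr addrACA -scalerDl subrK scale1r.
  have := ler_normD ((1 - t) *: (h + x)) (t *: (k + x)).
  rewrite !normrZ (ger0_norm t0) ger0_norm ?subr_ge0//.
  have := ler_wpM2l t0 ku.
  have := @ler_wpM2l _ (1 - t) ltac:(lra) _ _ hs; lra.
- by [].
- by move=> s /=; rewrite add0r subrr.
- move=> h h1; exists (`|h + x| - `|x|) => //=.
  by rewrite lerBlDr (le_trans (ler_normD _ _))// lerD2r.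
exists f; have := fD (- x) (- `|x|); rewrite /= addNr normr0 sub0r pairingNl.
by move=> /(_ (lexx _)); rewrite lerN2.
Qed.

(** Besides its usual role, this reduces identities between vectors to identities
    between real numbers, which [ring] decides. *)
Lemma dual_separates x y : (forall f, '<x, f> = '<y, f>) -> x = y.
Proof.
move=> xy; have [f fxy] := dual_norming (x - y).
apply/eqP; rewrite -subr_eq0 -normr_le0 (le_trans fxy)//.
by rewrite pairingDl pairingNl xy subrr.
Qed.
End ConvexSeparation.

(** * Neighbourhoods in terms of the norm *)

Section NormNeighbourhoods.
Context {R : realType} {X : normedModType R}.
Implicit Types (C : set X) (x y : X) (r : R).

Lemma interior_normP C x :
  interior C x <-> exists2 r : R, 0 < r & forall y, `|y - x| <= r -> C y.
Proof.
split=> [/nbhs_normP[r /= r0 rC]|[r r0 rC]].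
  exists (r / 2) => [|y yx]; first by rewrite divr_gt0.
  by apply: rC => /=; rewrite distrC; apply: le_lt_trans yx _; lra.
apply/nbhs_normP; exists r => //= y /=; rewrite distrC => yx.
by apply: rC; exact: ltW.
Qed.

Lemma closure_normP C x :
  closure C x <-> forall r, 0 < r -> exists2 y, C y & `|y - x| < r.
Proof.
split=> [Cx r r0|Cx V /nbhs_normP[r /= r0 rV]].
  have [|y [Cy /= yx]] := Cx (ball_ Num.norm x r); last by exists y => //; rewrite distrC.
  by apply/nbhs_normP; exists r.
have [y Cy yx] := Cx r r0.
by exists y; split=> //; apply: rV => /=; rewrite distrC.
Qed.

Lemma open_normP C :
  open C <-> forall x, C x -> exists2 r : R, 0 < r & forall y, `|y - x| <= r -> C y.
Proof.
rewrite openE; split=> [oC x /oC /interior_normP //|oC x /oC ?].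
exact/interior_normP.
Qed.

Lemma notin_closure C x : ~ closure C x ->
  exists2 r : R, 0 < r & forall y, closure C y -> r <= `|y - x|.
Proof.
move=> /(@open_normP (~` closure C)).1 [].
  exact/closed_openC/closed_closure.
move=> r r0 rC; exists r => // y Cy.
by rewrite leNgt; apply/negP => /ltW /rC.
Qed.
End NormNeighbourhoods.

Section BoundOnBall.
Context {R : realType} {X : normedModType R}.

Lemma dual_bound_ball (f : dual X) (r c : R) : 0 < r ->
  (forall h, `|h| <= r -> '<h, f> <= c) -> forall h, '<h, f> <= c / r * `|h|.
Proof.
move=> r0 fc h; have [->|h0] := eqVneq h 0; first by rewrite pairing0l normr0 mulr0.
have nh : 0 < `|h| by rewrite normr_gt0.
have := fc ((r / `|h|) *: h); rewrite normrZ gtr0_norm ?divr_gt0//.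
rewrite divfK ?gt_eqF// => /(_ (lexx _)); rewrite pairingZl.
by rewrite mulrAC -ler_pdivlMr ?invr_gt0// invrK mulrC -ler_pdivlMr// mulrAC.
Qed.
End BoundOnBall.

(** * Monotone operators and their Fitzpatrick functions *)

Section Monotone.
Context {R : realType} {X : normedModType R}.
Implicit Types (A B S : X -> set (dual X)) (x y z : X) (xs ys : dual X).

Lemma monotoneP A x y xs ys : monotone_op A -> A x xs -> A y ys ->
  0 <= '<x - y, xs> - '<x - y, ys>.
Proof. by move=> mA Ax Ay; have := mA (x, xs) (y, ys) Ax Ay. Qed.

(** Adjoining a related point to the graph gives a monotone extension, which
    cannot be proper. *)
Lemma maximal_mem A x xs : maximally_monotone A ->
  (forall y ys, A y ys -> 0 <= '<x - y, xs> - '<x - y, ys>) -> A x xs.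
Proof.
move=> [mA maxA] rel; apply: contrapT => nA; apply: maxA.
exists (fun y => A y `|` [set ys | y = x /\ ys = xs]); split.
  move=> [y ys] [z zs]; rewrite /gra /= => -[Ay|[-> ->]] [Az|[-> ->]].
  - exact: (mA (y, ys) (z, zs)).
  - have := rel _ _ Ay; rewrite !pairingE; lra.
  - exact: rel.
  - by rewrite /= !subrr pairing0l.
split=> [[y ys] Ay|]; first by left.
by move=> /(_ (x, xs)) h; apply: nA; apply: h; right.
Qed.

Lemma maximal_of_related S : monotone_op S ->
  (forall x xs, (forall y ys, S y ys -> 0 <= '<x - y, xs> - '<x - y, ys>) ->
    S x xs) -> maximally_monotone S.
Proof.
move=> mS rel; split=> // -[T [mT [ST nTS]]]; apply: nTS => -[x xs] Tx.
by apply: rel => y ys Sy; apply: (monotoneP mT Tx); exact: (ST (y, ys)).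
Qed.

(** Membership of [(x, xs, s)] in the epigraph of the Fitzpatrick function of
    [A]. *)
Definition fitz_epi A x xs (s : R) :=
  forall y ys, A y ys -> '<y, xs> + '<x, ys> - '<y, ys> <= s.

Lemma fitz_epi_gra A x xs : monotone_op A -> A x xs -> fitz_epi A x xs '<x, xs>.
Proof.
by move=> mA Ax y ys Ay; have := monotoneP mA Ax Ay; rewrite !pairingE; lra.
Qed.

(** The Fitzpatrick function of a maximal operator dominates the duality pairing:
    below it, a point would be related to the graph, hence on it, where the
    Fitzpatrick function is the pairing. *)
Lemma fitz_epi_ge_pairing A x xs s :
  maximally_monotone A -> fitz_epi A x xs s -> '<x, xs> <= s.
Proof.
move=> mA As; rewrite leNgt; apply/negP => sx.
have /As : A x xs.
  by apply: (maximal_mem mA) => y ys /As; rewrite !pairingE; lra.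
lra.
Qed.

(** The map [(x, xs, s) |-> (x - z, s - <z, xs>)] projects the epigraph of the
    Fitzpatrick function to a convex subset of [X * R].  It sends
    [(x, xs, <x, xs>)] to [(x - z, <x - z, xs>)], so an affine minorant of the image
    compares one slope at [z] with all the values of [A]. *)
Definition shifted_epi A z : set (X * R) :=
  [set hs | exists xs, fitz_epi A (hs.1 + z) xs (hs.2 + '<z, xs>)].

Lemma shifted_epi_convex A z : convex_pairs (shifted_epi A z).
Proof.
move=> h k s u t /andP[t0 t1] [xs /= Ah] [ys /= Ak].
exists ((1 - t) *: xs + t *: ys) => y w Ay /=.
have := ler_wpM2l t0 (Ak y w Ay).
have := @ler_wpM2l _ (1 - t) ltac:(lra) _ _ (Ah y w Ay).
rewrite !pairingE; lra.
Qed.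

Lemma shifted_epi_gra A z x xs :
  monotone_op A -> A x xs -> shifted_epi A z (x - z, '<x - z, xs>).
Proof.
move=> mA Ax; exists xs; rewrite /= pairingDl pairingNl !subrK; exact: fitz_epi_gra.
Qed.
End Monotone.

(** * Local boundedness *)

Section LocalBoundedness.
Context {R : realType} {X : completeNormedModType R}.
Implicit Types (B : X -> set (dual X)) (x y : X) (xs ys : dual X).

(** By monotonicity, [<x - y, ys>] is bounded above, for each [x] in the domain,
    over the values [ys] of [B] at points [y] near [x0].  The sets [E c] where [c] is
    such a bound are closed and convex and cover a ball around [x0], so by Baire
    one of them contains a ball, around some [x1]; a convex combination with a
    point of the domain on the other side of [x0] moves this ball to [x0].  There the
    bound is a bound on the norm of [ys]. *)
Lemma monotone_locally_bounded B x0 : monotone_op B -> interior (dom B) x0 ->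
  exists r K : R, [/\ 0 < r, 0 <= K,
    forall x, `|x - x0| <= r -> dom B x &
    forall x xs h, `|x - x0| <= r -> B x xs -> '<h, xs> <= K * `|h|].
Proof.
move=> mB /interior_normP[rho rho0 rhoB].
pose E (c : R) := [set x | forall y ys, B y ys -> `|y - x0| <= 1 -> '<x - y, ys> <= c].
have openE n : open (~` E n%:R).
  apply/open_normP => x /= /existsNP[y /existsNP[ys /not_implyP[By]]].
  move=> /not_implyP[y1 /negP]; rewrite -ltNge => nx.
  have [K K0 ysK] := dual_bounded ys.
  have K1 : 0 < 2 * (K + 1) by rewrite mulr_gt0// ltr_wpDl.
  exists (('<x - y, ys> - n%:R) / (2 * (K + 1))) => [|x' x'x].
    by rewrite divr_gt0// subr_gt0.
  move=> /(_ y ys By y1); apply/negP; rewrite -ltNge.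
  have := ysK (x - x'); rewrite distrC !pairingE.
  move: x'x; rewrite (ler_pdivlMr _ _ K1) => x'x.
  have := normr_ge0 (x' - x); rewrite !pairingE in x'x nx *; nra.
have domE x : dom B x -> exists n : nat, E n%:R x.
  move=> [xs Bx]; have [K K0 xsK] := dual_bounded xs.
  have [n nK] : exists n : nat, K * (`|x - x0| + 1) <= n%:R.
    exists (Num.bound (K * (`|x - x0| + 1))); apply/ltW/archi_boundP.
    by rewrite mulr_ge0// addr_ge0.
  exists n => y ys By y1; have := monotoneP mB Bx By; have := xsK (x - y).
  have : K * `|x - y| <= K * (`|x - x0| + 1).
    rewrite ler_wpM2l//; apply: le_trans (ler_distD x0 _ _) _.
    by rewrite lerD2l distrC.
  lra.
have [n [x1 [rho1 rho10 rho1E]]] : exists n : nat, exists x1, exists2 rho1 : R,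
    0 < rho1 & forall y, `|y - x1| <= rho1 -> E n%:R y.
  apply: contrapT => nE.
  have dE n : dense (~` E n%:R).
    move=> O [x Ox] /open_normP oO; apply: contrapT => nO; apply: nE.
    have [r r0 rO] := oO x Ox; exists n, x, r => // y /rO Oy.
    by apply: contrapT => ny; apply: nO; exists y.
  have [|||x [Ox nEx]] := @Baire _ X (fun n => ~` E n%:R) _ (interior (dom B)).
  - by move=> n; split.
  - by exists x0; apply/interior_normP; exists rho.
  - exact: open_interior.
  - have [n En] := domE x (interior_subset Ox).
    exact: (nEx n I).
pose s := rho / (`|x0 - x1| + 1).
have s0 : 0 < s by rewrite divr_gt0// ltr_wpDl.
have s10 : 0 < 1 + s by rewrite addr_gt0.
(* [x0] is between [x1] and a point of the domain, where some [E m] holds. *)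
have [|m Em] := domE (x0 + s *: (x0 - x1)).
  apply: rhoB; rewrite addrAC subrr add0r normrZ gtr0_norm// /s mulrAC.
  have n1 : 0 < `|x0 - x1| + 1 by rewrite ltr_wpDl.
  by rewrite (ler_pdivrMr _ _ n1) ler_wpM2l ?(ltW rho0)// lerDl.
pose r := Num.min (Num.min 1 rho) (s * rho1 / (1 + s) / 2).
have r0 : 0 < r by rewrite !lt_min ltr01 rho0 !divr_gt0 ?mulr_gt0.
have rr : r <= 1 /\ r <= rho by split; rewrite !ge_min lexx ?orbT.
have r2 : 2 * r <= s * rho1 / (1 + s).
  by rewrite mulrC -ler_pdivlMr// !ge_min lexx ?orbT.
pose c : R := n%:R + m%:R; have c0 : 0 <= c by rewrite addr_ge0.
exists r, (c / r); split=> [//||x xr|x xs h xr Bx]; first by rewrite divr_ge0// ltW.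
  by apply: rhoB; apply: le_trans xr rr.2.
apply: dual_bound_ball => // {}h hr.
have x_1 : `|x - x0| <= 1 by apply: le_trans xr rr.1.
have := Em _ _ Bx x_1.
have /rho1E/(_ _ _ Bx x_1) : `|x1 + ((1 + s) / s) *: (x + h - x0) - x1| <= rho1.
  rewrite addrAC subrr add0r normrZ gtr0_norm ?divr_gt0// mulrC.
  rewrite -ler_pdivlMr ?divr_gt0// invf_div mulrCA mulrA.
  apply: le_trans r2; rewrite addrAC; apply: le_trans (ler_normD _ _) _; lra.
have : s * ((1 + s) / s) = 1 + s by field; rewrite gt_eqF.
have n0 : 0 <= n%:R :> R by []. have m0 : 0 <= m%:R :> R by [].
rewrite !pairingE /c; move: ((1 + s) / s) => q sq.
move=> /(ler_wpM2l (ltW s0)) e1 e2; rewrite -(ler_pM2l s10).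
have e3 := congr1 (fun a => a * ('<x, xs> + '<h, xs> - '<x0, xs>)) sq.
have := mulr_ge0 (ltW s0) m0; rewrite /= in e3; lra.
Qed.
End LocalBoundedness.

(** * Tubes around segments *)

Section SegmentTubes.
Context {R : realType} {X : normedModType R}.
Implicit Types (x y z : X) (d t : R) (C : set X).

Definition seg_tube x z d : set X :=
  [set y | exists2 t, 0 <= t <= 1 & `|y - ((1 - t) *: x + t *: z)| < d].

Lemma seg_tube_left x z d : 0 < d -> seg_tube x z d x.
Proof.
move=> d0; exists 0; first by rewrite lexx ler01.
by rewrite subr0 scale1r scale0r addr0 subrr normr0.
Qed.

Lemma seg_tube_right x z d : 0 < d -> seg_tube x z d z.
Proof.
move=> d0; exists 1; first by rewrite lexx ler01.
by rewrite subrr scale0r scale1r add0r subrr normr0.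
Qed.

Lemma norm_convex_lt x y d t : 0 <= t <= 1 -> `|x| < d -> `|y| < d ->
  `|(1 - t) *: x + t *: y| < d.
Proof.
move=> /andP[t0 t1] xd yd; apply: le_lt_trans (ler_normD _ _) _.
rewrite !normrZ (ger0_norm t0) ger0_norm ?subr_ge0//.
have md : Num.max `|x| `|y| < d by rewrite gt_max xd.
apply: le_lt_trans md; have : `|x| <= Num.max `|x| `|y| by rewrite le_max lexx.
have : `|y| <= Num.max `|x| `|y| by rewrite le_max lexx orbT.
nra.
Qed.

Lemma seg_tube_convex x z d a b s : 0 <= s <= 1 ->
  seg_tube x z d a -> seg_tube x z d b ->
  seg_tube x z d ((1 - s) *: a + s *: b).
Proof.
move=> s01 [t t01 ta] [u u01 ub]; exists ((1 - s) * t + s * u).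
  by move: s01 t01 u01 => /andP[? ?] /andP[? ?] /andP[? ?]; apply/andP; split; nra.
have := norm_convex_lt s01 ta ub; congr (`| _ | < _).
by apply: dual_separates => f; rewrite !pairingE; ring.
Qed.

Lemma seg_tube_norm x z d a : seg_tube x z d a -> `|a - x| <= `|z - x| + d.
Proof.
move=> [t /andP[t0 t1] /ltW ta].
apply: le_trans (ler_distD ((1 - t) *: x + t *: z) _ _) _.
rewrite addrC lerD//.
have -> : (1 - t) *: x + t *: z - x = t *: (z - x).
  by apply: dual_separates => f; rewrite !pairingE; ring.
by rewrite normrZ ger0_norm// ler_piMl.
Qed.

Lemma seg_tube_open x z d : open (seg_tube x z d).
Proof.
apply/open_normP => y [t t01 yd].
exists ((d - `|y - ((1 - t) *: x + t *: z)|) / 2) => [|w wy].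
  by rewrite divr_gt0// subr_gt0.
exists t => //; apply: le_lt_trans (ler_distD y _ _) _; lra.
Qed.

Lemma seg_tube_convex_set x z d : convex_set (seg_tube x z d).
Proof.
move=> a b l; rewrite !inE => Ta Tb.
have -> : conv l a b = (1 - (1 - l%:num)) *: a + (1 - l%:num) *: b.
  by rewrite subKr.
apply: seg_tube_convex => //; apply/andP; split.
  by rewrite subr_ge0.
by rewrite lerBlDr lerDl.
Qed.

Lemma seg_tube_sub C x z d :
  (forall a b t, 0 <= t <= 1 -> C a -> C b -> C ((1 - t) *: a + t *: b)) ->
  (forall y, `|y - x| <= d -> C y) -> (forall y, `|y - z| <= d -> C y) ->
  seg_tube x z d `<=` C.
Proof.
move=> Cc xC zC y [t t01 yd].
pose e := y - ((1 - t) *: x + t *: z).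
have -> : y = (1 - t) *: (x + e) + t *: (z + e).
  by apply: dual_separates => f; rewrite /e !pairingE; ring.
by apply: Cc => //; [apply: xC|apply: zC]; rewrite addrAC subrr add0r ltW.
Qed.

(** Either [(z, zs)] is on the graph, and [a = z] works, or by type (FPV) it fails
    to be related to a point of the graph in the tube. *)
Lemma FPV_seg_tube (A : X -> set (dual X)) x0 z zs d :
  type_FPV A -> dom A x0 -> 0 < d ->
  exists a xs, [/\ A a xs, seg_tube x0 z d a & '<z - a, zs> <= '<z - a, xs> ].
Proof.
move=> [_ fpv] Ax0 d0; apply: contrapT => nex; apply: (nex).
exists z, zs; split; [|exact: seg_tube_right|exact: lexx].
apply: (fpv (seg_tube x0 z d)).
- exact: seg_tube_open.
- exact: seg_tube_convex_set.
- by exists x0; split=> //; exact: seg_tube_left.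
- exact: seg_tube_right.
move=> [a xs] [Aa [/= Ta _]]; rewrite leNgt; apply/negP => lt0; apply: nex.
exists a, xs; split=> //.
move: lt0; rewrite !pairingE; lra.
Qed.
End SegmentTubes.

(** * The domain of a maximally monotone operator *)

Section MaximalDomain.
Context {R : realType} {X : completeNormedModType R}.
Implicit Types (B : X -> set (dual X)) (x y z a u : X) (xs ys : dual X).

(** Comparing [b \in B a] with bounded values of [B] at [x0 + h] bounds its norm by
    its value in the direction [a - x0]. *)
Lemma monotone_growth B x0 (r K : R) a b : monotone_op B -> 0 < r -> 0 <= K ->
  (forall x, `|x - x0| <= r -> dom B x) ->
  (forall x xs h, `|x - x0| <= r -> B x xs -> '<h, xs> <= K * `|h|) ->
  B a b -> exists N : R, [/\ 0 <= N, r * N = '<a - x0, b> + K * (`|a - x0| + r) &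
    forall h, '<h, b> <= N * `|h| ].
Proof.
move=> mB r0 K0 rB rK Bab; pose c := '<a - x0, b> + K * (`|a - x0| + r).
have cb h : `|h| <= r -> '<h, b> <= c.
  move=> hr; have xr : `|x0 + h - x0| <= r by rewrite addrAC subrr add0r.
  have [w Bw] := rB _ xr.
  have := monotoneP mB Bab Bw; have := rK _ _ (x0 + h - a) xr Bw.
  have : K * `|x0 + h - a| <= K * (`|a - x0| + r).
    rewrite ler_wpM2l//; apply: le_trans (ler_distD x0 _ _) _.
    by rewrite addrC [`|x0 - a|]distrC lerD2l.
  rewrite /c !pairingE; lra.
have c0 : 0 <= c by have := cb 0; rewrite normr0 pairing0l; apply; exact: ltW.
exists (c / r); split; first by rewrite divr_ge0// ltW.
  by rewrite mulrC divfK// gt_eqF.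
exact: dual_bound_ball.
Qed.

Lemma mem_of_minorant B y f : maximally_monotone B ->
  (forall h s, shifted_epi B y (h, s) -> '<h, f> <= s) -> B y f.
Proof.
move=> maxB fmin; apply: (maximal_mem maxB) => x xs Bx.
have := fmin _ _ (shifted_epi_gra y maxB.1 Bx); rewrite !pairingE; lra.
Qed.

Lemma shifted_epi_ge0 B y s : maximally_monotone B ->
  shifted_epi B y (0, s) -> 0 <= s.
Proof.
by move=> maxB [xs /= /(fitz_epi_ge_pairing maxB)]; rewrite add0r; lra.
Qed.

(** The shifted Fitzpatrick epigraph at a point [y] of the segment is bounded above
    near [0], since the part of the segment near [u] can be moved in all directions
    with bounded values.  A minorant of it is an element of [B y]. *)
Lemma segment_to_interior_dom B z u t : maximally_monotone B ->
  dom B z -> interior (dom B) u -> 0 < t <= 1 -> dom B ((1 - t) *: z + t *: u).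
Proof.
move=> maxB [zs Bz] intu /andP[t0 t1]; set y := (X in dom B X).
have [r [K [r0 K0 rB rK]]] := monotone_locally_bounded maxB.1 intu.
have [|||f fmin] := @convex_minorant _ _ (shifted_epi B y) (t * r)
  ((1 - t) * '<z - y, zs> + K * (`|u - y| + r)) _ _
  (fun s => @shifted_epi_ge0 B y s maxB).
- exact: shifted_epi_convex.
- exact: mulr_gt0.
- move=> h hr; have xr : `|u + t^-1 *: h - u| <= r.
    by rewrite addrAC subrr add0r normrZ gtr0_norm ?invr_gt0// ler_pdivrMl.
  have [xs Bx] := rB _ xr; have bx := rK _ _ (u + t^-1 *: h - y) xr Bx.
  have : K * `|u + t^-1 *: h - y| <= K * (`|u - y| + r).
    rewrite ler_wpM2l//; apply: le_trans (ler_distD u _ _) _.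
    by rewrite addrC lerD2l.
  have := @shifted_epi_convex _ _ B y _ _ _ _ t ltac:(by rewrite (ltW t0))
    (shifted_epi_gra y maxB.1 Bz) (shifted_epi_gra y maxB.1 Bx).
  set k := (X in shifted_epi B y (X, _)); set s := (X in shifted_epi B y (_, X)).
  move=> Bks bK; have -> : h = k.
    apply: dual_separates => f; rewrite /k /y !pairingE.
    by field; rewrite gt_eqF.
  exists s => //; rewrite /s lerD2l.
  have := mulr_ge0 K0 (addr_ge0 (normr_ge0 (u - y)) (ltW r0)); nra.
by exists f; exact: mem_of_minorant.
Qed.

(** A small displacement of the point of the segment is absorbed by a
    displacement of the endpoint [u]. *)
Lemma closure_segment_interior B a u t : maximally_monotone B ->
  closure (dom B) a -> interior (dom B) u -> 0 < t <= 1 ->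
  interior (dom B) ((1 - t) *: a + t *: u).
Proof.
move=> maxB /closure_normP cla intu /andP[t0 t1].
have [r r0 rint] := (open_normP _).1 (open_interior (dom B)) u intu.
have tr0 : 0 < t * r / 2 by rewrite divr_gt0 ?mulr_gt0.
apply/interior_normP; exists (t * r / 2) => // y ya.
have [z Bz za] := cla _ tr0.
pose u' := u + t^-1 *: (y - ((1 - t) *: a + t *: u) - (1 - t) *: (z - a)).
have -> : y = (1 - t) *: z + t *: u'.
  apply: dual_separates => f; rewrite /u' !pairingE.
  by field; rewrite gt_eqF.
apply: segment_to_interior_dom => //; last by rewrite t0.
apply: rint; rewrite addrAC subrr add0r normrZ gtr0_norm ?invr_gt0//.
rewrite ler_pdivrMl//; apply: le_trans (ler_normB _ _) _.
have : `|(1 - t) *: (z - a)| <= `|z - a|.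
  by rewrite normrZ ger0_norm ?subr_ge0// ler_piMl//; lra.
lra.
Qed.

Lemma interior_dom_convex B x y t : maximally_monotone B -> 0 <= t <= 1 ->
  interior (dom B) x -> interior (dom B) y ->
  interior (dom B) ((1 - t) *: x + t *: y).
Proof.
move=> maxB /andP[+ t1] Bx By; rewrite le_eqVlt => /predU1P[<-|t0].
  by rewrite subr0 scale1r scale0r addr0.
apply: closure_segment_interior => //; last by rewrite t0.
by apply: subset_closure; exact: interior_subset.
Qed.

(** The role of weak-star compactness is played here by [convex_minorant]: bounded
    values at points tending to [a] make the sum of the shifted epigraph at [a]
    and the cone [K * norm] nonnegative over [0]. *)
Lemma dom_of_bounded_limit B a K : maximally_monotone B -> 0 <= K ->
  (forall e : R, 0 < e -> exists x xs,
    [/\ B x xs, `|x - a| <= e & forall h, '<h, xs> <= K * `|h|]) -> dom B a.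
Proof.
move=> maxB K0 lim.
pose D := [set hs : X * R | exists k s,
  shifted_epi B a (k, s) /\ s + K * `|hs.1 - k| <= hs.2].
have [x1 [b1 [B1 _ _]]] := lim 1 ltr01.
have [|||f fmin] := @convex_minorant _ _ D 1
  ('<x1 - a, b1> + K * (1 + `|x1 - a|)) _ ltr01.
- move=> h h' s s' t t01 [k [u [/= Bku hs]]] [k' [u' [/= Bku' hs']]].
  exists ((1 - t) *: k + t *: k'), ((1 - t) * u + t * u').
  split; first exact: shifted_epi_convex.
  move: t01 => /andP[t0 t1] /=.
  have : K * `|(1 - t) *: h + t *: h' - ((1 - t) *: k + t *: k')| <=
      K * ((1 - t) * `|h - k| + t * `|h' - k'|).
    rewrite ler_wpM2l// opprD addrACA -!scalerBr.
    apply: le_trans (ler_normD _ _) _.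
    by rewrite !normrZ (ger0_norm t0) ger0_norm ?subr_ge0.
  have := ler_wpM2l t0 hs'.
  have := @ler_wpM2l _ (1 - t) ltac:(lra) _ _ hs; lra.
- move=> s [k [u [[xs /= Bku]]]]; rewrite sub0r normrN => us.
  have [L L0 xsL] := dual_bounded xs.
  apply/ler_addgt0Pl => e e0.
  have LK : 0 < L + K + 1 by rewrite ltr_wpDl ?addr_ge0.
  have [x [b [Bx xa bK]]] := lim (e / (L + K + 1)) ltac:(by rewrite divr_gt0).
  have := Bku x b Bx; have := bK (- k); have := bK (x - a); have := xsL (a - x).
  rewrite [`|a - x|]distrC normrN.
  move: xa; rewrite (ler_pdivlMr _ _ LK).
  have := normr_ge0 (x - a); rewrite !pairingE; nra.
- move=> h h1; exists ('<x1 - a, b1> + K * `|h - (x1 - a)|).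
    rewrite lerD2l ler_wpM2l//; apply: le_trans (ler_normB _ _) _.
    by rewrite lerD2r.
  exists (x1 - a), '<x1 - a, b1>; split => //=.
  exact: shifted_epi_gra maxB.1 B1.
exists f; apply: mem_of_minorant => // h s Bhs; apply: fmin.
by exists h, s; split=> //=; rewrite subrr normr0 mulr0 addr0.
Qed.
End MaximalDomain.

(** * Growth of a monotone operator along a segment *)

Section GrowthAlongSegments.
Context {R : realType} {X : completeNormedModType R}.
Implicit Types (A B S : X -> set (dual X)) (x y z a u : X) (xs ys zs b : dual X).

(** Along the segment the direction [a - x0] of [monotone_growth] is
    [t *: (z - x0)] up to an error shorter than half the radius, which costs at most
    half of the norm of [b]. *)
Lemma growth_near_segment B x0 z : monotone_op B -> interior (dom B) x0 ->
  exists r k : R, [/\ 0 < r, r <= 1, 0 <= k &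
    forall a b (t : R), 0 <= t <= 1 -> `|a - ((1 - t) *: x0 + t *: z)| <= r -> B a b ->
    exists N : R, [/\ 0 <= N, r * N <= t * '<z - x0, b> + k &
      forall h, '<h, b> <= N * `|h| ] ].
Proof.
move=> mB int0; have [r [K [r0 K0 rB rK]]] := monotone_locally_bounded mB int0.
have [r' r'0 /and3P[r'1 r'r _]] := @exists_pos_le R [:: 1; r / 2]
  ltac:(by rewrite /= ltr01 divr_gt0).
exists r', (K * (`|z - x0| + 1 + r)); split=> //.
  by rewrite mulr_ge0// addr_ge0 ?(ltW r0)// addr_ge0.
move=> a b t t01 ad Bab.
have [N [N0 rN Nb]] := monotone_growth mB r0 K0 rB rK Bab.
exists N; split=> //.
set e := a - _ in ad; have := Nb e.
have : N * `|e| <= N * r' by rewrite ler_wpM2l.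
have aE : '<a - x0, b> = t * '<z - x0, b> + '<e, b>.
  by rewrite /e !pairingE; ring.
have : K * (`|a - x0| + r) <= K * (`|z - x0| + 1 + r).
  rewrite ler_wpM2l// lerD2r.
  have -> : a - x0 = t *: (z - x0) + e.
    by apply: dual_separates => f; rewrite /e !pairingE; ring.
  apply: le_trans (ler_normD _ _) _; rewrite lerD ?(le_trans ad)//.
  by move: t01 => /andP[t0 t1]; rewrite normrZ ger0_norm// ler_piMl.
rewrite aE in rN; nra.
Qed.

(** Off the closure of the domain, [z] keeps a fixed distance from the points [a]
    of the domain.  So [z - a] is, up to a small error, a multiple of [z - x0] by a
    factor at least [q], and the norm of [b \in B a] is bounded by its value in the
    direction [z - a]. *)
Lemma growth_away B x0 z : monotone_op B -> interior (dom B) x0 ->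
  ~ closure (dom B) z ->
  exists d c k q : R, [/\ 0 < d <= 1, 0 < c, 0 <= k, 0 < q &
   (forall a (t : R), closure (dom B) a -> 0 <= t <= 1 ->
      `|a - ((1 - t) *: x0 + t *: z)| <= d -> q <= 1 - t) /\
   (forall a b, B a b -> seg_tube x0 z d a ->
    exists N : R, [/\ 0 <= N, c * N - k <= '<z - a, b> &
      forall h, '<h, b> <= N * `|h| ]) ].
Proof.
move=> mB int0 nz; have [r [k [r0 r1 k0 grow]]] := growth_near_segment z mB int0.
have [p p0 pz] := notin_closure nz.
have clB a : dom B a -> closure (dom B) a by exact: subset_closure.
pose V := `|z - x0|.
have V0 : 0 < V.
  apply: lt_le_trans p0 _; rewrite /V distrC.
  exact: (pz _ (clB _ (interior_subset int0))).
pose q := p / 2 / V; have q0 : 0 < q by rewrite !divr_gt0.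
have qr20 : 0 < q * r / 2 by rewrite divr_gt0// mulr_gt0.
have [d d0 /and4P[dr dp dq _]] := @exists_pos_le R [:: r; p / 2; q * r / 2]
  ltac:(by rewrite /= r0 qr20 divr_gt0).
have away a t : closure (dom B) a -> 0 <= t <= 1 ->
    `|a - ((1 - t) *: x0 + t *: z)| <= d -> q <= 1 - t.
  move=> /pz pa /andP[t0 t1] ad.
  rewrite /q (ler_pdivrMr _ _ V0).
  have : `|a - z| <= `|a - ((1 - t) *: x0 + t *: z)| + (1 - t) * V.
    apply: le_trans (ler_distD ((1 - t) *: x0 + t *: z) _ _) _.
    rewrite lerD2l; have -> : (1 - t) *: x0 + t *: z - z = (1 - t) *: (x0 - z).
      by apply: dual_separates => f; rewrite !pairingE; ring.
    by rewrite normrZ ger0_norm ?subr_ge0// distrC.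
  lra.
exists d, (q * r / 2), (q * k + k / r * (V + q * r)), q; split=> //.
- by rewrite d0 (le_trans dr).
- by rewrite !(addr_ge0, mulr_ge0)// ?invr_ge0; apply: ltW.
split=> // a b Bab [t t01 /ltW ad].
have [N [N0 rN Nb]] := grow a b t t01 (le_trans ad dr) Bab.
have qt := away a t (clB a (ex_intro _ b Bab)) t01 ad.
exists N; split=> //; set e := a - _ in ad.
have eN : '<e, b> <= N * d by apply: le_trans (Nb e) _; rewrite ler_wpM2l.
have -> : '<z - a, b> = (1 - t) * '<z - x0, b> - '<e, b>.
  by rewrite /e !pairingE; ring.
have := Nb (- (z - x0)); rewrite normrN pairingNl -/V => TV.
move: ('<z - x0, b>) rN TV => T rN TV; move: t01 => /andP[t0 t1].
have kr : k / r * r = k by rewrite divfK// gt_eqF.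
have kr0 : 0 <= k / r by rewrite divr_ge0// ltW.
have qr0 : 0 < q * r by rewrite mulr_gt0.
have kqV : 0 <= k / r * (V + q * r) by rewrite mulr_ge0// addr_ge0 ?ltW.
have Nd : N * d <= N * (q * r / 2) by rewrite ler_wpM2l.
have [T0|T0] := leP 0 T.
  have tT : t * T <= T by rewrite ler_piMl.
  have : q * T <= (1 - t) * T by rewrite ler_wpM2r.
  have : q * (r * N) <= q * (T + k) by rewrite ler_wpM2l ?(ltW q0)//; lra.
  lra.
have Nk : N <= k / r.
  by rewrite (ler_pdivlMr _ _ r0) mulrC; nra.
have : (1 - t) * T >= - (N * V).
  have : t * T <= 0 by rewrite mulr_ge0_le0// ltW.
  lra.
have : N * (V + q * r) <= k / r * (V + q * r).
  by rewrite ler_wpM2r// addr_ge0 ?ltW.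
have := mulr_ge0 (ltW q0) k0; lra.
Qed.
End GrowthAlongSegments.

(** * Points with a gap *)

Section GapPoints.
Context {R : realType} {X : completeNormedModType R}.
Implicit Types (A B S : X -> set (dual X)) (x y z a u : X) (xs ys zs : dual X).

Definition gap S z zs (e : R) :=
  forall x xs, S x xs -> e <= '<z - x, zs - xs>.

Lemma gap_add A B z zs (e : R) x xs ys : gap (op_add A B) z zs e ->
  A x xs -> B x ys -> e <= '<z - x, zs> - '<z - x, xs> - '<z - x, ys>.
Proof.
move=> gS Ax Bx; have := gS x (xs + ys).
by rewrite !pairingE => /(_ ltac:(by exists xs => //; exists ys)); lra.
Qed.

Lemma monotone_op_add A B : monotone_op A -> monotone_op B ->
  monotone_op (op_add A B).
Proof.
move=> mA mB [x s] [y s']; rewrite /gra /=.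
move=> [a Aa [b Bb <-]] [a' Aa' [b' Bb' <-]].
have := monotoneP mA Aa Aa'; have := monotoneP mB Bb Bb'.
rewrite !pairingE; lra.
Qed.

(** A point [z2] slightly beyond [z] is still in [dom B], and monotonicity with
    respect to it bounds [<z - x0, b>] from above, hence also the norm of [b], for
    all values [b] of [B] at points of the tube.  This bound [N0] does not depend on
    the slope chosen afterwards, which is [zs] plus [N0] times a functional norming
    [z - x0]; the gap is then at most a multiple of the radius of the tube. *)
Lemma no_gap_interior A B x0 z zs (e : R) : type_FPV A -> maximally_monotone B ->
  dom A x0 -> interior (dom B) x0 -> interior (dom B) z -> 0 < e ->
  ~ gap (op_add A B) z zs e.
Proof.
move=> fpvA maxB Ax0 int0 intz e0 gS.
have [r [k [r0 r1 k0 grow]]] := growth_near_segment z maxB.1 int0.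
have openD := (open_normP _).1 (open_interior (dom B)).
have [p0 p00 p0B] := openD x0 int0; have [p1 p10 p1B] := openD z intz.
pose V := `|z - x0|; have V0 : 0 <= V by exact: normr_ge0.
have V1 : 0 < V + 1 by rewrite ltr_wpDl.
pose n := p1 / (V + 1); have n0 : 0 < n by rewrite divr_gt0.
pose z2 := z + n *: (z - x0).
have [c Bc] : dom B z2.
  apply: interior_subset; apply: p1B; rewrite /z2 addrAC subrr add0r normrZ gtr0_norm//.
  by rewrite /n -/V mulrAC (ler_pdivrMr _ _ V1) ler_wpM2l ?(ltW p10)// lerDl.
have [L L0 cL] := dual_bounded c.
have [f fV] := dual_norming (z - x0); have [Lf Lf0 fL] := dual_bounded f.
have nr0 : 0 < n * r / 2 by rewrite divr_gt0// mulr_gt0.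
pose K1 := L * ((1 + n) * V + 1).
have K10 : 0 <= K1 by rewrite mulr_ge0// addr_ge0// mulr_ge0// addr_ge0// ltW.
pose N0 := (K1 + n * k) / (n * r / 2).
have N00 : 0 <= N0 by rewrite divr_ge0 ?(ltW nr0)// addr_ge0// mulr_ge0// ltW.
have Q0 : 0 < 2 * (N0 * (Lf + 1) + 1).
  by rewrite mulr_gt0// ltr_wpDl// mulr_ge0// addr_ge0.
have [d d0] := @exists_pos_le R [:: r; p0; p1; n * r / 2; e / (2 * (N0 * (Lf + 1) + 1))]
  ltac:(by rewrite /= r0 p00 p10 nr0 divr_gt0).
rewrite /= => /and5P[dr dp0 dp1 dn /andP[de _]].
have [a [xs [Aa Ta lexs]]] := FPV_seg_tube z (zs + N0 *: f) fpvA Ax0 d0.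
have [b Bab] : dom B a.
  apply: interior_subset; apply: seg_tube_sub Ta.
  - by move=> ? ? ? ? ? ?; exact: interior_dom_convex.
  - by move=> y yd; apply: p0B; exact: le_trans dp0.
  - by move=> y yd; apply: p1B; exact: le_trans dp1.
case: Ta => t t01 /ltW ad.
have [N [Nge0 rN Nb]] := grow a b t t01 (le_trans ad dr) Bab.
have := gap_add gS Aa Bab.
move: t01 => /andP[t0 t1]; set h := a - _ in ad.
have zaE g : '<z - a, g> = (1 - t) * '<z - x0, g> - '<h, g>.
  by rewrite /h !pairingE; ring.
have hN : '<h, b> <= N * d by apply: le_trans (Nb h) _; rewrite ler_wpM2l.
have hNm : - '<h, b> <= N * d.
  by rewrite -pairingNl; apply: le_trans (Nb _) _; rewrite normrN ler_wpM2l.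
have hf : '<h, f> <= Lf * d by apply: le_trans (fL h) _; rewrite ler_wpM2l.
have TV : - '<z - x0, b> <= N * V by rewrite -pairingNl /V -normrN.
have z2b : (1 + n - t) * '<z - x0, b> - '<h, b> <= K1.
  have -> : (1 + n - t) * '<z - x0, b> - '<h, b> = '<z2 - a, b>.
    by rewrite /z2 /h !pairingE; ring.
  apply: (@le_trans _ _ '<z2 - a, c>).
    by have := monotoneP maxB.1 Bc Bab; lra.
  apply: le_trans (cL _) _; rewrite ler_wpM2l//.
  have -> : z2 - a = (1 + n - t) *: (z - x0) - h.
    by apply: dual_separates => g; rewrite /z2 /h !pairingE; ring.
  have n1t : 0 <= 1 + n - t by rewrite subr_ge0 (le_trans t1)// lerDl ltW.
  apply: le_trans (ler_normB _ _) _; rewrite normrZ ger0_norm//.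
  rewrite lerD ?(le_trans ad)// ?(le_trans dr)// ler_wpM2r//.
  by rewrite lerBlDr lerDl.
rewrite !zaE in lexs *; rewrite !pairingDr !pairingZr in lexs.
have NN0 : N <= N0.
  rewrite (ler_pdivlMr _ _ nr0).
  have nN : N * d <= N * (n * r / 2) by rewrite ler_wpM2l.
  have nd0 : 0 <= N * d by rewrite mulr_ge0// ltW.
  have nk0 : 0 <= n * k by rewrite mulr_ge0// ltW.
  have := ler_wpM2l (ltW n0) rN.
  move: ('<z - x0, b>) z2b => T z2b.
  have [T0|T0] := leP 0 T.
    have : 0 <= (1 - t) * T by rewrite mulr_ge0// subr_ge0.
    have : n * (t * T) <= n * T by rewrite ler_wpM2l ?(ltW n0)// ler_piMl.
    lra.
  have : n * (t * T) <= 0 by rewrite mulr_ge0_le0 ?(ltW n0)// mulr_ge0_le0// ltW.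
  lra.
have e1 : (1 - t) * - '<z - x0, b> <= (1 - t) * (N0 * '<z - x0, f>).
  rewrite ler_wpM2l ?subr_ge0//; apply: le_trans TV _.
  by rewrite ler_pM.
have e2 : N0 * '<h, f> <= N0 * (Lf * d) by rewrite ler_wpM2l.
have e3 : N * d <= N0 * d by rewrite ler_wpM2r// ltW.
move: de; rewrite (ler_pdivlMr _ _ Q0) => de.
lra.
Qed.
End GapPoints.

Section NoGap.
Context {R : realType} {X : completeNormedModType R}.
Implicit Types (A B S : X -> set (dual X)) (x y z a u : X) (xs ys zs : dual X).

(** Moving towards a point of the graph costs [t * (1 - t)] times a constant, so a
    gap survives small moves. *)
Lemma gap_move S z zs (e t : R) x0 s0 : monotone_op S -> S x0 s0 ->
  0 <= t <= 1 -> gap S z zs e ->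
  gap S ((1 - t) *: z + t *: x0) ((1 - t) *: zs + t *: s0)
    ((1 - t) * (e - t * '<z - x0, zs - s0>)).
Proof.
move=> mS S0 /andP[t0 t1] gS x s Sx.
have := ler_wpM2l t0 (monotoneP mS S0 Sx).
have := @ler_wpM2l _ (1 - t) ltac:(lra) _ _ (gS x s Sx).
rewrite !pairingE; lra.
Qed.

Lemma no_gap_closure A B x0 z zs (e : R) : type_FPV A -> maximally_monotone B ->
  dom A x0 -> interior (dom B) x0 -> closure (dom B) z -> 0 < e ->
  ~ gap (op_add A B) z zs e.
Proof.
move=> fpvA maxB Ax0 int0 clz e0 gS.
have [a0 Aa0] := Ax0; have [b0 Bb0] := interior_subset int0.
have S0 : op_add A B x0 (a0 + b0) by exists a0 => //; exists b0.
have mS := monotone_op_add fpvA.1.1 maxB.1.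
set q := '<z - x0, zs - (a0 + b0)>.
have q1 : 0 < 4 * (`|q| + 1) by rewrite mulr_gt0// ltr_wpDl.
have [t t0 /and3P[t4 tq _]] := @exists_pos_le R [:: 4^-1; e / (4 * (`|q| + 1))]
  ltac:(by rewrite /= invr_gt0 ltr0n (divr_gt0 e0 q1)).
have t01 : 0 <= t <= 1 by rewrite (ltW t0)/=; lra.
apply: (no_gap_interior fpvA maxB Ax0 int0 _ _ (gap_move mS S0 t01 gS)).
  by apply: closure_segment_interior => //; rewrite t0; lra.
rewrite -/q; move: tq; rewrite (ler_pdivlMr _ _ q1) => tq.
have : t * q <= t * `|q| by rewrite ler_wpM2l ?ler_norm// ltW.
move=> tqn; rewrite mulr_gt0; lra.
Qed.

(** The inequality that type (FPV) gives at a point [p] close to [a] becomes one of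
    order [t] that involves [ys] in the direction of [z] only: monotonicity
    between [a] and [y] removes the main part of [p - y], and between [x0] and [y]
    the part of [u - y] that does not point to [z]. *)
Lemma FPV_slope_ineq A x0 xs0 a av y ys m u z p (s t : R) :
  monotone_op A -> A x0 xs0 -> A a av -> A y ys -> s <= 1 -> 0 <= t <= 1 ->
  u = (1 - s) *: x0 + s *: z -> p = (1 - t) *: a + t *: u ->
  '<p - y, av + m> <= '<p - y, ys> ->
  '<p - y, m> <=
    t * (s * '<z - y, ys> + (1 - s) * '<x0 - y, xs0> - '<u - y, av>).
Proof.
move=> mA A0 Aa Ay s1 /andP[t0 t1] uE pE ley.
have E1 : '<p - y, m> <= t * ('<u - y, ys> - '<u - y, av>).
  have t1' : 0 <= 1 - t by rewrite subr_ge0.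
  have := ler_wpM2l t1' (monotoneP mA Aa Ay).
  move: ley; rewrite pE !pairingE; lra.
apply: le_trans E1 _; rewrite ler_wpM2l// lerB//.
have -> : '<u - y, ys> = s * '<z - y, ys> + (1 - s) * '<x0 - y, ys>.
  by rewrite uE !pairingE; ring.
rewrite lerD2l ler_wpM2l ?subr_ge0//.
by have := monotoneP mA A0 Ay; lra.
Qed.

(** The last hypothesis is what a gap at [(z, zs)] gives in the tube.  Interior
    points [p = (1 - t) *: a + t *: u] of the domain of [B] tend to [a] with [t], and
    so do the points [y] that type (FPV) yields at [p] with the slope [av + m], while
    the values of [B] at [y] stay bounded: in [FPV_slope_ineq] the hypothesis
    bounds the right-hand side by [t] times a constant minus [t] times a
    multiple of the norm of [b \in B y].  So that norm is bounded, and [<p - y, m>],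
    which is about [g] times the relative distance from [y] to [p], is of order
    [t].  By maximality of [B] the limit [a] is in its domain. *)
Lemma dom_of_gap A B x0 z a av (d d0 c C : R) :
  type_FPV A -> maximally_monotone B -> dom A x0 -> interior (dom B) x0 ->
  A a av -> closure (dom B) a -> 0 < d -> d <= d0 / 2 -> seg_tube x0 z d a ->
  0 < c -> 0 <= C ->
  (forall y ys b, A y ys -> B y b -> seg_tube x0 z d0 y -> exists N : R,
    [/\ 0 <= N, c * N + '<z - y, ys> <= C & forall h, '<h, b> <= N * `|h| ]) ->
  dom B a.
Proof.
move=> fpvA maxB Ax0 int0 Aa cla d_gt0 dd0 Ta c0 C0 gapC.
apply: contrapT => nBa.
have a0 : 0 < `|a - x0|.
  rewrite normr_gt0 subr_eq0; apply/negP => /eqP ax0; apply: nBa.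
  by rewrite ax0; exact: interior_subset.
apply: nBa.
pose V := `|z - x0|; pose W := V + d0.
have V0 : 0 <= V by exact: normr_ge0.
have d00 : 0 < d0 by lra.
have W0 : 0 < W by rewrite ltr_wpDl.
have tubeW y : seg_tube x0 z d0 y -> `|y - x0| <= W by exact: seg_tube_norm.
have wide y y' : seg_tube x0 z d y -> `|y' - y| <= d0 / 2 -> seg_tube x0 z d0 y'.
  move=> [l l01 yl] yy'; exists l => //.
  apply: le_lt_trans (ler_distD y _ _) _; lra.
have Ta0 := wide a a Ta ltac:(by rewrite subrr normr0 divr_ge0// ltW).
have openD := (open_normP _).1 (open_interior (dom B)).
have [p0 p00 p0B] := openD x0 int0.
(* The weight [s] keeps [u] in the interior; being positive, it makes [z - y] a part
   of [u - y]. *)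
pose s := p0 / (p0 + V).
have pV : 0 < p0 + V by rewrite ltr_wpDr.
have s0 : 0 < s by rewrite divr_gt0.
have s1 : s <= 1 by rewrite (ler_pdivrMr _ _ pV) mul1r lerDl.
pose u := (1 - s) *: x0 + s *: z.
have ux0 : `|u - x0| = s * V.
  have -> : u - x0 = s *: (z - x0).
    by apply: dual_separates => g; rewrite /u !pairingE; ring.
  by rewrite normrZ gtr0_norm.
have intu : interior (dom B) u.
  apply: p0B; rewrite ux0 /s mulrAC (ler_pdivrMr _ _ pV) ler_wpM2l ?(ltW p00)//.
  by rewrite lerDr ltW.
have uV : `|u - x0| <= V by rewrite ux0 ler_piMl// ltW.
have Tu : seg_tube x0 z d u.
  by exists s; [rewrite (ltW s0)|rewrite /u subrr normr0].
have [m am] := dual_norming (a - x0); have [Lm Lm0 mL] := dual_bounded m.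
have mA := fpvA.1.1; have [xs0 Axs0] := Ax0; have [L0 L00 xs0L] := dual_bounded xs0.
have [La La0 asL] := dual_bounded av.
have sC0 : 0 <= s * C by rewrite mulr_ge0// ltW.
have VW0 : 0 < V + W by rewrite ltr_wpDl.
(* [D] collects all the bounds that do not depend on [t]. *)
pose D := 1 + s * C + (L0 * W + La * (V + W)).
have D0 : 0 < D.
  have := mulr_ge0 L00 (ltW W0); have := mulr_ge0 La0 (ltW VW0).
  by rewrite /D; lra.
have sc0 : 0 < s * c by rewrite mulr_gt0.
pose g := `|a - x0| / 2.
have g0 : 0 < g by rewrite divr_gt0.
pose E := D / g * W + 1 + (V + W).
have Dg0 : 0 < D / g by rewrite divr_gt0.
have E0 : 0 < E by have := mulr_gt0 Dg0 W0; rewrite /E; lra.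
have LmV0 : 0 < 2 * g + Lm * V + 1.
  have := mulr_ge0 Lm0 V0; lra.
apply: (@dom_of_bounded_limit _ _ _ _ (D / (s * c)) maxB) => [|n n0].
  by rewrite divr_ge0// ltW.
have [t t0 /and4P[t1 tg tn _]] :=
  @exists_pos_le R [:: 1; g / (2 * g + Lm * V + 1); n / E]
  ltac:(by rewrite /= ltr01 !divr_gt0).
have t01 : 0 <= t <= 1 by rewrite (ltW t0).
move: tg tn; rewrite (ler_pdivlMr _ _ LmV0) (ler_pdivlMr _ _ E0) => tg tn.
pose p := (1 - t) *: a + t *: u.
have intp : interior (dom B) p.
  by apply: closure_segment_interior => //; rewrite t0.
have Tp : seg_tube x0 z d p.
  by exact: seg_tube_convex.
have [r r0 rB] := openD p intp.
have Lm1 : 0 < Lm + 1 by rewrite ltr_wpDl.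
have [d' d'0] := @exists_pos_le R [:: r; p0; d0 / 2; t / (Lm + 1)]
  ltac:(by rewrite /= r0 p00 !divr_gt0).
rewrite /= => /and5P[d'r d'p0 d'd0 d't _].
move: d't; rewrite (ler_pdivlMr _ _ Lm1) => d't.
have [y [ys [Ay Ty ley]]] := FPV_seg_tube p (av + m) fpvA Ax0 d'0.
have [b Bb] : dom B y.
  apply: interior_subset; apply: seg_tube_sub Ty.
  - by move=> ? ? ? ? ? ?; exact: interior_dom_convex.
  - by move=> ? yd; apply: p0B; exact: le_trans d'p0.
  - by move=> ? yd; apply: rB; exact: le_trans d'r.
case: Ty => l /[dup] l01 /andP[l0 l1] yl.
have Ty0 : seg_tube x0 z d0 y.
  apply: wide (seg_tube_convex l01 (seg_tube_left x0 z d_gt0) Tp) _.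
  by apply: ltW; apply: lt_le_trans yl _.
have [N [N0 cN Nb]] := gapC _ _ _ Ay Bb Ty0.
have yx0 := tubeW y Ty0; have ax0 := tubeW a Ta0.
set h := y - _ in yl; move/ltW in yl.
have hm : '<h, m> <= t.
  apply: le_trans (mL h) _; apply: (@le_trans _ _ (Lm * d')).
    by rewrite ler_wpM2l.
  move: d't d'0; clear; lra.
have um : - '<u - x0, m> <= Lm * V.
  rewrite -pairingNl; apply: le_trans (mL _) _.
  by rewrite normrN ler_wpM2l.
have pm : g <= '<p - x0, m>.
  have -> : '<p - x0, m> = (1 - t) * '<a - x0, m> + t * '<u - x0, m>.
    by rewrite /p !pairingE; ring.
  have e1 : (1 - t) * (2 * g) <= (1 - t) * '<a - x0, m>.
    by rewrite ler_wpM2l ?subr_ge0// /g mulrC divfK.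
  move: e1 tg (ler_wpM2l (ltW t0) um) (ltW t0); clear; lra.
have E1 : (1 - l) * g - t <= '<p - y, m>.
  have -> : '<p - y, m> = (1 - l) * '<p - x0, m> - '<h, m>.
    by rewrite /h !pairingE; ring.
  by rewrite lerB// ler_wpM2l// subr_ge0.
have E2 := FPV_slope_ineq (u := u) (p := p) mA Axs0 Aa Ay s1 t01 erefl erefl ley.
have E3 : '<x0 - y, xs0> <= L0 * W.
  by apply: le_trans (xs0L _) _; rewrite distrC ler_wpM2l.
have E4 : - '<u - y, av> <= La * (V + W).
  rewrite -pairingNl; apply: le_trans (asL _) _; rewrite normrN ler_wpM2l//.
  apply: le_trans (ler_distD x0 _ _) _.
  by rewrite lerD// distrC.
have E5 : (1 - s) * '<x0 - y, xs0> <= L0 * W.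
  apply: (@le_trans _ _ ((1 - s) * (L0 * W))).
    by rewrite ler_wpM2l// subr_ge0.
  by rewrite ler_piMl ?mulr_ge0 ?(ltW W0)// lerBlDr lerDl ltW.
have E6 : s * '<z - y, ys> <= s * (C - c * N).
  by rewrite ler_wpM2l ?(ltW s0)// lerBrDl.
(* The first term controls the distance from [y] to [p], the second the norm of
   [b]. *)
have key : (1 - l) * g + t * (s * c * N) <= t * D.
  have := ler_wpM2l (ltW t0) (lerD (lerD E6 E5) E4).
  move: (le_trans E1 E2); rewrite /D; clear; lra.
have ND : N <= D / (s * c).
  rewrite (ler_pdivlMr _ _ sc0) -(ler_pM2l t0).
  have : 0 <= (1 - l) * g by rewrite mulr_ge0 ?subr_ge0// ltW.
  move: key; clear; lra.
exists y, b; split=> //; last first.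
  by move=> k'; apply: le_trans (Nb k') _; rewrite ler_wpM2r.
have lD : (1 - l) * g <= t * D.
  apply: le_trans key; rewrite lerDl mulr_ge0 ?(ltW t0)//.
  by rewrite mulr_ge0// ltW.
have lDg : 1 - l <= t * (D / g).
  by rewrite mulrA (ler_pdivlMr _ _ g0).
have -> : y - a = t *: (u - a) - (1 - l) *: (p - x0) + h.
  by apply: dual_separates => k'; rewrite /h /p !pairingE; ring.
apply: le_trans tn; apply: le_trans (ler_normD _ _) _.
have n1 : `|t *: (u - a) - (1 - l) *: (p - x0)| <= t * (V + W) + (1 - l) * W.
  apply: le_trans (ler_normB _ _) _.
  rewrite !normrZ (gtr0_norm t0) (ger0_norm (_ : 0 <= 1 - l)) ?subr_ge0//.
  apply: lerD; last first.
    rewrite ler_wpM2l ?subr_ge0//; apply/tubeW/(wide p p Tp).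
    by rewrite subrr normr0 divr_ge0// ltW.
  rewrite ler_wpM2l ?(ltW t0)//; apply: le_trans (ler_distD x0 _ _) _.
  by rewrite lerD// distrC.
have n2 : (1 - l) * W <= t * (D / g) * W by rewrite ler_wpM2r// ltW.
have n3 : 0 <= Lm * d' by rewrite mulr_ge0// ltW.
move: n1 n2 n3 yl d't; rewrite /E; clear; lra.
Qed.

(** A steep slope produces [a \in dom A] in the tube with [<z - a, av>] larger than
    the gap allows on [dom B]; but [dom_of_gap] puts [a] in [dom B]. *)
Lemma no_gap_outside A B x0 z zs (e : R) : type_FPV A -> maximally_monotone B ->
  (forall x, dom A x -> closure (dom B) x) ->
  dom A x0 -> interior (dom B) x0 -> ~ closure (dom B) z -> 0 < e ->
  ~ gap (op_add A B) z zs e.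
Proof.
move=> fpvA maxB AB Ax0 int0 nz e0 gS.
have [d0 [c [k [q [/andP[d00 d01] c0 k0 q0 [away grow]]]]]] :=
  growth_away maxB.1 int0 nz.
pose V := `|z - x0|; pose W := V + d0.
have V0 : 0 < V.
  rewrite normr_gt0 subr_eq0; apply/negP => /eqP zx; apply: nz.
  by rewrite zx; apply: subset_closure; exact: interior_subset.
have W0 : 0 < W by rewrite addr_gt0.
have tubeW y : seg_tube x0 z d0 y -> `|y - x0| <= W.
  exact: seg_tube_norm.
have [Lz Lz0 zsL] := dual_bounded zs.
pose C := Lz * (V + W) + k.
have C0 : 0 <= C by rewrite addr_ge0// mulr_ge0// addr_ge0// ltW.
have gapC a av b : A a av -> B a b -> seg_tube x0 z d0 a ->
    exists N : R, [/\ 0 <= N, c * N + '<z - a, av> <= C &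
      forall h, '<h, b> <= N * `|h| ].
  move=> Aa Bb Ta; have [N [N0 cN Nb]] := grow a b Bb Ta.
  exists N; split=> //.
  have := gap_add gS Aa Bb.
  have : '<z - a, zs> <= Lz * (V + W).
    apply: le_trans (zsL _) _; rewrite ler_wpM2l//.
    apply: le_trans (ler_distD x0 _ _) _.
    by rewrite lerD2l distrC tubeW.
  rewrite /C; lra.
have [f fV] := dual_norming (z - x0); have [Lf Lf0 fL] := dual_bounded f.
(* For [a] in [dom A] and in the tube, [<z - a, f>] is at least [q * V] up to an error
   of order [d], so that [<z - a, M *: f>] exceeds [C]. *)
pose M := (C + 2) / (q * V).
have qV0 : 0 < q * V by rewrite mulr_gt0.
have M0 : 0 <= M by rewrite divr_ge0 ?(ltW qV0)// addr_ge0.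
have ML : 0 < M * Lf + 1 by rewrite ltr_wpDl// mulr_ge0.
have [d d_gt0 /and3P[dd0 dM _]] := @exists_pos_le R [:: d0 / 2; (M * Lf + 1)^-1]
  ltac:(by rewrite /= invr_gt0 ML divr_gt0).
have [a [av [Aa Ta lea]]] := FPV_seg_tube z (M *: f) fpvA Ax0 d_gt0.
have Ta0 : seg_tube x0 z d0 a.
  by case: Ta => t t01 ta; exists t => //; apply: lt_le_trans ta _; lra.
have aC : C < '<z - a, av>.
  apply: lt_le_trans lea; case: Ta => t t01 /ltW ta.
  have qt := away a t (AB a ltac:(by exists av)) t01 ltac:(lra).
  set h := a - _ in ta; rewrite pairingZr.
  have -> : '<z - a, f> = (1 - t) * '<z - x0, f> - '<h, f>.
    by rewrite /h !pairingE; ring.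
  have e1 : q * V <= (1 - t) * '<z - x0, f> by rewrite ler_pM// ltW.
  have e2 : '<h, f> <= Lf * d by apply: le_trans (fL h) _; rewrite ler_wpM2l.
  have e3 : M * (q * V) = C + 2 by rewrite /M divfK// gt_eqF.
  have e4 : M * Lf * d <= 1.
    have : (M * Lf + 1) * d <= 1 by rewrite -ler_pdivlMl// mulr1.
    lra.
  have := ler_wpM2l M0 e1; have := ler_wpM2l M0 e2; lra.
have [b Bb] : dom B a.
  apply: (dom_of_gap fpvA maxB Ax0 int0 Aa _ d_gt0 dd0 Ta c0 C0 gapC).
  by apply: AB; exists av.
have [N [N0 cN _]] := gapC _ _ _ Aa Bb Ta0.
have := mulr_ge0 (ltW c0) N0; lra.
Qed.
End NoGap.

(** * Maximality of the sum *)

Section SumOfMaximal.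
Context {R : realType} {X : completeNormedModType R}.
Implicit Types (A B S : X -> set (dual X)) (x y z : X) (xs ys zs : dual X).

(** The sandwich hypothesis is the derivative at [(z, zs)] of the absence of gaps:
    on the segment from [(z, zs)] to a point where it fails, the pairing with the
    graph exceeds zero to first order in [t], which is a gap.  Of the two affine
    inequalities obtained, one has a constant [b] of the right sign to put [z] in
    the domain of [A] or of [B], and evaluating it at [z] then gives [b = 0]. *)
Lemma sum_mem_of_no_gap A B x0 z zs :
  maximally_monotone A -> maximally_monotone B ->
  dom A x0 -> interior (dom B) x0 ->
  (forall w ws (e : R), 0 < e -> ~ gap (op_add A B) w ws e) ->
  gap (op_add A B) z zs 0 -> op_add A B z zs.
Proof.
move=> maxA maxB [a0 Aa0] int0 nogap rel.
have [r [K [r0 K0 rB rK]]] := monotone_locally_bounded maxB.1 int0.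
have [L L0 zsL] := dual_bounded (- zs).
pose Q := [set hu : X * R | shifted_epi B z (hu.1, hu.2 + '<hu.1, zs>)].
have [|||f [b [fA fB]]] := @convex_sandwich _ _ (shifted_epi A z) Q (x0 - z)
  '<x0 - z, a0> r ((K + L) * (r + `|x0 - z|)) (@shifted_epi_convex _ _ A z)
  _ _ (shifted_epi_gra z maxA.1 Aa0) r0.
- move=> h k s u t t01 Bh Bk.
  have := shifted_epi_convex t01 Bh Bk; rewrite /Q /=.
  congr (shifted_epi B z (_, _)); rewrite !pairingE /=; ring.
- move=> h s u [xs /= Axs] [ys /= Bys]; rewrite leNgt; apply/negP => su.
  pose us := xs + ys; pose q := '<h, us - zs>.
  have q1 : 0 < 2 * (`|q| + 1) by rewrite mulr_gt0// ltr_wpDl.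
  have [t t0 /and3P[t1 tq _]] :=
    @exists_pos_le R [:: 1; - (s + u) / (2 * (`|q| + 1))]
    ltac:(by rewrite /= ltr01 divr_gt0// oppr_gt0).
  move: tq; rewrite (ler_pdivlMr _ _ q1) => tq.
  apply: (nogap ((1 - t) *: z + t *: (h + z)) ((1 - t) *: zs + t *: us)
    (t * - (s + u) / 2)).
    by rewrite !(mulr_gt0, divr_gt0)// oppr_gt0.
  move=> x _ [a Aa [c Bc <-]].
  have Sx : op_add A B x (a + c) by exists a => //; exists c.
  have := @ler_wpM2l _ (1 - t) ltac:(lra) _ _ (rel x _ Sx).
  have : t * (- (s + u) + q) <= t * '<h + z - x, us - (a + c)>.
    rewrite ler_wpM2l ?(ltW t0)//.
    have := Axs x a Aa; have := Bys x c Bc.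
    rewrite /q /us !pairingE; lra.
  have : t * (t * - q) <= t * (- (s + u) / 2).
    rewrite ler_wpM2l ?(ltW t0)//.
    have : t * - q <= t * `|q|.
      by rewrite ler_wpM2l ?(ltW t0)// -normrN ler_norm.
    lra.
  rewrite /q !pairingE; lra.
- move=> h hr; have hxr : `|h + z - x0| <= r by move: hr; rewrite opprB addrA.
  have [xs Bx] := rB _ hxr; exists ('<h, xs> - '<h, zs>).
    have := rK _ _ h hxr Bx; have := zsL h.
    have : (K + L) * `|h| <= (K + L) * (r + `|x0 - z|).
      rewrite ler_wpM2l ?addr_ge0// -[h in `|h|](subrK (x0 - z)).
      by apply: le_trans (ler_normD _ _) _; rewrite lerD2r.
    rewrite pairingNr; lra.
  rewrite /Q /= subrK; have := shifted_epi_gra z maxB.1 Bx.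
  by rewrite addrK.
have fA' x a : A x a -> '<x - z, f> + b <= '<x - z, a>.
  by move=> Ax; apply: fA; exact: shifted_epi_gra maxA.1 Ax.
have fB' x c : B x c -> - ('<x - z, f> + b) <= '<x - z, c> - '<x - z, zs>.
  move=> Bx; apply: fB; rewrite /Q /= subrK.
  exact: shifted_epi_gra maxB.1 Bx.
have Af : 0 <= b -> A z f.
  move=> b0; apply: (maximal_mem maxA) => x a /fA'; rewrite !pairingE; lra.
have Bf : b <= 0 -> B z (zs - f).
  move=> b0; apply: (maximal_mem maxB) => x c /fB'; rewrite !pairingE; lra.
have b0 : b = 0.
  apply/eqP; rewrite eq_le; apply/andP; split.
    rewrite leNgt; apply/negP => b0; have := fA' _ _ (Af (ltW b0)).
    by rewrite subrr !pairing0l; lra.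
  rewrite leNgt; apply/negP => b0; have := fB' _ _ (Bf (ltW b0)).
  by rewrite subrr !pairing0l; lra.
exists f; first by apply: Af; rewrite b0.
by exists (zs - f); [apply: Bf; rewrite b0|rewrite addrC subrK].
Qed.

Lemma normal_cone0 (C : set X) x : C x -> normal_cone C x 0.
Proof.
by move=> Cx; split=> //; apply: ge_ereal_sup => _ [c Cc <-]; rewrite pairing0r.
Qed.

Lemma normal_cone_le0 (C : set X) x xs c :
  normal_cone C x xs -> C c -> '<c - x, xs> <= 0.
Proof.
move=> [_ supC] Cc; rewrite -lee_fin; apply: le_trans supC.
by apply: ereal_sup_ubound; exists c.
Qed.

(** This is [B + N_C = B]: adding a normal vector to a value of [B] leaves it
    related to the whole graph of [B]. *)
Lemma op_add_normal_cone A B : maximally_monotone B ->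
  op_add (op_add A (normal_cone (closure (dom B)))) B = op_add A B.
Proof.
move=> maxB; apply/funext => x; apply/seteqP; split=> xs.
  move=> [_ [a Aa [n Nn <-]] [b Bb <-]]; exists a => //.
  exists (n + b); last by rewrite addrA.
  apply: (maximal_mem maxB) => y ys By.
  have Cy : closure (dom B) y by apply: subset_closure; exists ys.
  have := normal_cone_le0 Nn Cy; have := monotoneP maxB.1 Bb By.
  rewrite !pairingE; lra.
move=> [a Aa [b Bb <-]]; exists a; last by exists b.
exists a => //; exists 0; last by rewrite addr0.
by apply: normal_cone0; apply: subset_closure; exists b.
Qed.
End SumOfMaximal.

Unset Implicit Arguments.

Theorem theorem3p2 (R : realType) (X : completeNormedModType R)
    (A B : X -> set (dual X))
    (hA : maximally_monotone A) (hB : maximally_monotone B)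
    (hAB : dom A `&` interior (dom B) !=set0)
    (hFPV : type_FPV (op_add A (normal_cone (closure (dom B))))) :
  maximally_monotone (op_add A B).
Proof.
move: hAB => [x0 [[a0 Aa0] int0]].
rewrite -(op_add_normal_cone A hB).
set T := op_add A _ in hFPV *.
have TC x : dom T x -> closure (dom B) x.
  by move=> [_ [a Aa [n [Cx _] _]]].
have Tx0 : dom T x0.
  exists (a0 + 0); exists a0 => //; exists 0 => //.
  by apply: normal_cone0; apply: subset_closure; exact: interior_subset.
apply: maximal_of_related => [|z zs rel].
  exact: monotone_op_add hFPV.1.1 hB.1.
apply: (sum_mem_of_no_gap hFPV.1 hB Tx0 int0) => [w ws e e0|x xs Sx].
  have [clw|nclw] := pselect (closure (dom B) w).
    exact: no_gap_closure Tx0 int0 clw e0.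
  exact: no_gap_outside TC Tx0 int0 nclw e0.
by have := rel x xs Sx; rewrite !pairingE; lra.
Qed.
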